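(* Let $k\ge 2$ be a fixed integer, let $\varepsilon>0$, and let $C>0$ be a fixed constant. Then for all sufficiently large real $x$, all real $H$ with $1\le H\le Cx$, all real $\vartheta$, and all positive integers $a,q$ with $q\le x$, $(a,q)=1$ and $$\left|\vartheta-\frac{a}{q}\right|\leq \frac{1}{q^{2}},$$ we have $$ \sum_{1\leq h\leq H}\ \sum_{\substack{1\leq n\leq x\\ n\in\mathcal{Q}_{k}}}e(\vartheta hn)\;\ll\; \left(Hx^{k/(2k-1)}+ q+ \frac{Hx}{q}\right)x^{\varepsilon}, $$ where $h$ and $n$ run over integers and the implied constant may depend on $k$ and $\varepsilon$ (and on $C$).
   Context: $e(t)=e^{2\pi i t}$. $\mathcal{Q}_k$ denotes the set of positive $k$-free integers, i.e. the positive integers $r$ such that for positive integers $m$, $m^k\mid r$ implies $m=1$. The notation $f\ll g$ means $|f|\le C'g$ for some constant $C'>0$ (the implied constant). *)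

(* Defs.v *)
From mathcomp Require Import all_boot all_order all_algebra.
From mathcomp Require Import all_classical all_reals all_analysis.
From mathcomp Require Import complex.

Set Implicit Arguments.
Unset Strict Implicit.
Unset Printing Implicit Defensive.

Import Order.TTheory GRing.Theory Num.Theory.
Import numFieldNormedType.Exports.

Local Open Scope classical_set_scope.
Local Open Scope ring_scope.

(* e(t) = exp(2 pi i t) *)
Definition expe (R : realType) (t : R) : R[i] :=
  (cos (2 * pi * t) +i* sin (2 * pi * t))%C.

Definition kfree (k : nat) : set nat :=
  [set r | (0 < r)%N /\
    forall m : nat, (0 < m)%N -> (m ^ k %| r)%N -> m = 1%N].

(* For H, x >= 0, truncn is the floor function, so h runs over the integers
   1 <= h <= H and n over the k-free integers 1 <= n <= x. *)
Definition kfree_expsum (R : realType) (k : nat) (H x theta : R) : R[i] :=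
  \sum_(1 <= h < (Num.truncn H).+1)
    \sum_(1 <= n < (Num.truncn x).+1 | n \in kfree k)
      expe (theta * h%:R * n%:R).

(* Main.v *)
From Pilot Require Import Defs.
From mathcomp Require Import all_boot all_order all_algebra.
From mathcomp Require Import all_classical all_reals all_analysis.
From mathcomp Require Import complex.
From mathcomp Require Import zify ring lra.

(* Writing the indicator of the k-free integers as the sum of mu(d) over d^k | n turns the
   sum into geometric sums over multiples of h d^k, each bounded by
   min(x / d^k, 1 / ||theta h d^k||).  Put y = x^(1/(2k-1)).  The terms d > y contribute
   O(H x y^(1-k)) = O(H y^k) trivially.  For d <= y, put l = h d^k: each l <= H y^k occurs at
   most tau(l) << x^(eps/2) times, and the sum of min(Hx / l, 1 / ||theta l||) is estimated
   by Vaughan's lemma, cutting the range of l into blocks of length about q/2, on which the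
   points theta l are 1/(2q)-separated mod 1. *)

Set Implicit Arguments.
Unset Strict Implicit.
Unset Printing Implicit Defensive.

Import Order.TTheory GRing.Theory Num.Theory.
Import numFieldNormedType.Exports.
(* Gives [expe] precedence over the exponentiation [expe] of extended reals. *)
Import Pilot.Defs.

Local Open Scope classical_set_scope.
Local Open Scope ring_scope.

(** * Divisor bound *)

(** The products [p ^ i * d] with [i <= a] and [d %| m] exhaust the divisors: the [p]-part of a
    divisor has exponent at most [a], and its cofactor divides [m] by Gauss. *)
Lemma size_divisors_pfactorM (p a m : nat) :
  prime p -> coprime p m -> (0 < m)%N ->
  (size (divisors (p ^ a * m)) <= a.+1 * size (divisors m))%N.
Proof.
move=> p_pr co_pm m_gt0.
have -> : (a.+1 * size (divisors m) =
    size [seq (p ^ i * d)%N | i <- iota 0 a.+1, d <- divisors m])%N.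
  by rewrite size_allpairs size_iota.
have pa_gt0 : (0 < p ^ a)%N by rewrite expn_gt0 prime_gt0.
apply: uniq_leq_size (divisors_uniq _) _ => d.
rewrite -dvdn_divisors ?muln_gt0 ?pa_gt0 // => dv.
have d_gt0 : (0 < d)%N by apply: dvdn_gt0 dv; rewrite muln_gt0 pa_gt0.
have [e co_pe def_d] := pfactor_coprime p_pr d_gt0.
have le_a : (logn p d <= a)%N.
  have := dvdn_leq_log p _ dv; rewrite muln_gt0 pa_gt0 => /(_ m_gt0).
  by rewrite [(p ^ a * m)%N]mulnC logn_Gauss // pfactorK.
have ed : (e %| p ^ a * m)%N by apply: dvdn_trans dv; rewrite def_d dvdn_mulr.
apply/allpairsP; exists (logn p d, e); split; last by rewrite mulnC.
- by rewrite mem_iota add0n ltnS.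
- by rewrite -dvdn_divisors //; move: ed; rewrite Gauss_dvdr // coprime_sym coprimeXl.
Qed.

(** With [t = a %/ j] one has [a + 1 <= j * (t + 1) <= j * 2 ^ t]; the [j]-th power gives the claim
    because [t * j <= a]. *)
Lemma expn_succ_le (j a : nat) : (0 < j)%N -> (a.+1 ^ j <= j ^ j * 2 ^ a)%N.
Proof.
move=> j_gt0.
have h : (a.+1 <= j * 2 ^ (a %/ j))%N.
  apply: (@leq_trans (j * (a %/ j).+1)).
    by rewrite mulnC; apply: ltn_ceil.
  by rewrite leq_pmul2l // ltn_expl.
apply: (@leq_trans ((j * 2 ^ (a %/ j)) ^ j)); first by rewrite leq_exp2r.
rewrite expnMn leq_pmul2l ?expn_gt0 ?j_gt0 // -expnM.
by rewrite leq_exp2l // leq_divM.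
Qed.

(** Induction on a strict bound [N] for the primes of [n]. Removing [p ^ a] costs [(a + 1) ^ j],
    which is at most [B * 2 ^ a <= B * p ^ a] for any [p], and at most [2 ^ (a * j) <= p ^ a] once
    [p >= 2 ^ j]. Hence only the primes below [2 ^ j] contribute a factor [B], and the exponent in
    [K N] stops growing there. *)
Lemma size_divisors_le (j : nat) : (0 < j)%N ->
  exists2 K, (0 < K)%N &
    forall n, (0 < n)%N -> (size (divisors n) ^ j <= K * n)%N.
Proof.
move=> j_gt0.
pose B := (j ^ j)%N; pose K N := (B ^ minn N (2 ^ j))%N.
have expW m n e : (m <= n -> m ^ e <= n ^ e)%N.
  by case: e => // e; rewrite leq_exp2r.
have B_gt0 : (0 < B)%N by rewrite expn_gt0 j_gt0.
have K_mono N : (K N <= K N.+1)%N.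
  rewrite /K leq_pexp2l //; lia.
have main N : forall n, (0 < n)%N -> (forall p, p \in primes n -> (p < N)%N) ->
    (size (divisors n) ^ j <= K N * n)%N.
  elim: N => [|N IH] n n_gt0 pn.
    have [n1|n_gt1] := leqP n 1.
      have -> : n = 1%N by lia.
      by rewrite /K min0n expn0 exp1n.
    by have := pn (pdiv n); rewrite ltn0 pi_pdiv n_gt1 => /(_ isT).
  have [Nn|Nn] := boolP (N \in primes n); last first.
    apply: leq_trans (IH n n_gt0 _) _.
      move=> p p_n; have := pn p p_n; rewrite ltnS leq_eqVlt => /orP[/eqP pN|//].
      by rewrite pN (negPf Nn) in p_n.
    by rewrite leq_mul2r K_mono orbT.
  have N_pr : prime N by move: Nn; rewrite mem_primes => /and3P[].
  have [m co_Nm def_n] := pfactor_coprime N_pr n_gt0.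
  set a := logn N n in def_n.
  have m_gt0 : (0 < m)%N by move: n_gt0; rewrite def_n muln_gt0 => /andP[].
  have hm : (size (divisors m) ^ j <= K N * m)%N.
    apply: IH => // p; rewrite mem_primes => /and3P[p_pr _ pm].
    have := pn p; rewrite mem_primes p_pr n_gt0 def_n dvdn_mulr // => /(_ isT).
    rewrite ltnS leq_eqVlt => /orP[/eqP pN|//].
    by move: co_Nm; rewrite -pN prime_coprime // pm.
  have hd : (size (divisors n) <= a.+1 * size (divisors m))%N.
    rewrite def_n mulnC; apply: size_divisors_pfactorM => //.
  apply: (@leq_trans ((a.+1 * size (divisors m)) ^ j)); first by rewrite leq_exp2r.
  rewrite expnMn def_n [(m * _)%N]mulnC.
  have [N_lt|N_ge] := ltnP N (2 ^ j).
    have -> : K N.+1 = (B * K N)%N.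
      by rewrite /K -expnS; congr (B ^ _)%N; lia.
    rewrite -mulnA [(K N * _)%N]mulnCA mulnA.
    apply: leq_mul => //.
    apply: leq_trans (expn_succ_le a j_gt0) _.
    by rewrite leq_mul2l expW ?prime_gt1 ?orbT.
  have -> : K N.+1 = K N by rewrite /K; congr (B ^ _)%N; lia.
  rewrite [(K N * _)%N]mulnCA.
  apply: leq_mul => //.
  apply: (@leq_trans ((2 ^ a) ^ j)); first by rewrite leq_exp2r // ltn_expl.
  by rewrite -expnM mulnC expnM; apply: expW.
exists (K (2 ^ j)%N); first by rewrite expn_gt0 B_gt0.
move=> n n_gt0.
(* This bound exceeds every prime of [n], and being at least [2 ^ j] it makes the constant
   independent of [n]. *)
have := main (maxn (2 ^ j) n.+1) n n_gt0.
have -> : K (maxn (2 ^ j) n.+1) = K (2 ^ j)%N by rewrite /K; congr (B ^ _)%N; lia.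
apply=> p; rewrite mem_primes => /and3P[_ _ /(dvdn_leq n_gt0)].
by lia.
Qed.

(** * Moebius sums over k-th power divisors *)

Section Moebius.
Variable R : numDomainType.

Definition moebius (d : nat) : R :=
  \prod_(p <- primes d) (if logn p d == 1%N then -1 else 0).

Lemma moebius1 : moebius 1 = 1.
Proof. by rewrite /moebius /= big_nil. Qed.

Lemma norm_moebius_le1 d : `|moebius d| <= 1.
Proof.
rewrite /moebius; elim/big_ind: _ => [|x y hx hy|p _].
- by rewrite normr1.
- by rewrite normrM mulr_ile1.
- by case: ifP; rewrite ?normrN ?normr1 ?normr0.
Qed.

Lemma moebius_primeM p d : prime p -> (0 < d)%N -> ~~ (p %| d)%N ->
  moebius (p * d) = - moebius d.
Proof.
move=> p_pr d_gt0 pNd; have p_gt0 := prime_gt0 p_pr.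
have p_primes : perm_eq (primes (p * d)) (p :: primes d).
  apply: uniq_perm (primes_uniq _) _ _.
    by rewrite /= primes_uniq mem_primes (negPf pNd) !andbF.
  by move=> r; rewrite primesM // primes_prime // !inE.
rewrite /moebius (perm_big _ p_primes) big_cons.
rewrite lognM // logn_prime // eqxx lognE p_pr d_gt0 (negPf pNd) /= mulN1r.
congr (- _); apply: eq_big_seq => r; rewrite mem_primes => /and3P[r_pr _ rd].
rewrite lognM // logn_prime //.
by case: (eqVneq r p) => [rp|//]; rewrite -rp rd in pNd.
Qed.

Lemma moebius_sqr p d : prime p -> (0 < d)%N -> (p ^ 2 %| d)%N -> moebius d = 0.
Proof.
move=> p_pr d_gt0 p2d.
have : (2 <= logn p d)%N by rewrite -pfactor_dvdn.
have : p \in primes d.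
  by rewrite mem_primes p_pr d_gt0 (dvdn_trans _ p2d) // expnS dvdn_mulr.
rewrite /moebius => /(big_rem p) -> /=.
by case: (logn p d) => [|[|?]] //; rewrite /= mul0r.
Qed.

(* Multiplying or dividing by a prime [p] with [p ^ k %| n] is an involution of the set of
   [d] with [d ^ k %| n], up to non-squarefree [d], and it changes the sign of [moebius]. *)
Lemma sum_moebius_kpower (k N n : nat) : (0 < k)%N -> (0 < n <= N)%N ->
  \sum_(1 <= d < N.+1 | (d ^ k %| n)%N) moebius d = (n \in kfree k)%:R.
Proof.
move=> k_gt0 /andP[n_gt0 n_le].
have [nk|nk] := boolP (n \in kfree k).
  move: nk; rewrite inE => -[_ nk].
  rewrite big_mkcond (bigD1_seq 1%N) /= ?iota_uniq ?mem_index_iota //; last by lia.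
  rewrite exp1n dvd1n moebius1 big_seq_cond big1 ?addr0 // => d.
  rewrite mem_index_iota => /andP[/andP[d_gt0 _] d1].
  by case: ifP => // /(nk _ d_gt0) d1'; rewrite d1' in d1.
(* A number that is not [k]-free is divisible by [m ^ k] with [m > 1], hence by the [k]-th power of
   a prime factor of [m]. *)
have [p p_pr pn] : exists2 p, prime p & (p ^ k %| n)%N.
  apply: contrapT => h; move/negP: nk; apply; rewrite inE; split=> // m m_gt0 mn.
  apply: contrapT => m1; apply: h; exists (pdiv m); first by apply: pdiv_prime; lia.
  by apply: dvdn_trans mn; rewrite dvdn_exp2r // pdiv_dvd.
pose s := [seq d <- index_iota 1 N.+1 | (d ^ k %| n)%N].
rewrite -big_filter -/s.
(* The range is no restriction: [d ^ k %| n] forces [1 <= d <= n <= N]. *)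
have sE d : (d \in s) = (d ^ k %| n)%N.
  rewrite mem_filter mem_index_iota ltnS; case dn: (d ^ k %| n)%N => //=.
  have dk_gt0 := dvdn_gt0 n_gt0 dn.
  have d_gt0 : (0 < d)%N by move: dk_gt0; rewrite expn_gt0; case: (d) (k) k_gt0 => [|?] [].
  rewrite d_gt0 (leq_trans _ n_le) //; apply: leq_trans (dvdn_leq n_gt0 dn).
  by rewrite -{1}(expn1 d) leq_pexp2l.
have p_gt0 := prime_gt0 p_pr.
have s_gt0 d : d \in s -> (0 < d)%N.
  by rewrite mem_filter mem_index_iota => /andP[_ /andP[]].
(* Multiples of [p ^ 2] are fixed; they do no harm because [moebius] vanishes there. Every other [d]
   gains or loses one factor [p]. *)
pose f d := if (p %| d)%N then (if (p ^ 2 %| d)%N then d else (d %/ p)%N) else (p * d)%N.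
have f_in d : d \in s -> f d \in s.
  rewrite !sE /f; case: ifPn => pd dn.
    case: ifP => // _; apply: dvdn_trans dn; apply: dvdn_exp2r.
    by apply/dvdnP; exists p; rewrite mulnC divnK.
  rewrite expnMn Gauss_dvd ?pn //.
  by rewrite coprimeXl // coprimeXr // prime_coprime.
have fK d : d \in s -> f (f d) = d.
  move=> ds; rewrite /f; case: (boolP (p %| d)%N) => pd; last first.
    rewrite dvdn_mulr // expnS expn1 dvdn_pmul2l // (negPf pd).
    by rewrite mulKn.
  case: (boolP (p ^ 2 %| d)%N) => p2d; first by rewrite pd p2d.
  have -> : (p %| d %/ p)%N = false.
    by apply: contraNF p2d; rewrite dvdn_divRL // -expnSr.
  by rewrite mulnC divnK.
have f_mu d : d \in s -> moebius (f d) = - moebius d.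
  move=> ds; have d_gt0 := s_gt0 d ds.
  rewrite /f; case: (boolP (p %| d)%N) => pd; last exact: moebius_primeM.
  case: (boolP (p ^ 2 %| d)%N) => p2d; first by rewrite (moebius_sqr p_pr) // oppr0.
  rewrite -[in RHS](divnK pd) mulnC moebius_primeM ?opprK //.
    by rewrite divn_gt0 // dvdn_leq.
  by apply: contra p2d; rewrite dvdn_divRL // -expnSr.
have s_uniq : uniq s by rewrite filter_uniq // iota_uniq.
have f_perm : perm_eq s [seq f d | d <- s].
  apply: uniq_perm => //.
    by rewrite map_inj_in_uniq // => d e ds es /(congr1 f); rewrite !fK.
  move=> d; apply/idP/mapP => [ds|[e es ->]]; last exact: f_in.
  by exists (f d); rewrite ?f_in ?fK.
(* Reindexing by [f] shows that the sum equals its own negative, so it is zero. *)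
have : \sum_(d <- s) moebius d = - \sum_(d <- s) moebius d.
  rewrite {1}(perm_big _ f_perm) big_map -sumrN.
  by apply: eq_big_seq.
by move/eqP; rewrite eq_sym eqNr => /eqP.
Qed.

End Moebius.

(** * Geometric sums *)

Section Expe.
Variable R : realType.
Implicit Types (a b t : R) (n : nat).

Lemma expeD a b : expe (a + b)%R = expe a * expe b.
Proof.
rewrite /expe mulrDr cosD sinD.
by apply/eqP; rewrite eq_complex /=; apply/andP; split; apply/eqP; ring.
Qed.

Lemma expe0 : expe (0 : R) = 1.
Proof. by rewrite /expe mulr0 cos0 sin0. Qed.

Lemma expe1 : expe (1 : R) = 1.
Proof. by rewrite /expe mulr1 mulr_natl cos2pi sin2pi. Qed.

Lemma expeMn a n : (expe (a * n%:R) : R[i]) = expe a ^+ n.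
Proof.
elim: n => [|n IH]; first by rewrite mulr0 expe0 expr0.
by rewrite -natr1 mulrDr mulr1 expeD IH exprSr.
Qed.

Lemma expe_int (z : int) : expe (z%:~R : R) = 1.
Proof.
have h n : expe (n%:R : R) = 1 by rewrite -[n%:R]mul1r expeMn expe1 expr1n.
case: z => n; first exact: h.
by have := expe0; rewrite -(subrr (n.+1%:R : R)) expeD h mul1r NegzE mulrNz.
Qed.

Lemma norm_expe a : `|expe a : R[i]| = 1.
Proof. by rewrite normc_def /= cos2Dsin2 sqrtr1. Qed.

(** With [u = t / 2], the mean value theorem gives [sin u >= u * cos u], so [sin t = 2 * sin u * cos
    u >= t * cos u ^+ 2]; and [cos t >= 0] means [cos u ^+ 2 >= 1 / 2]. *)
Lemma sin_ge_half t : 0 <= t <= pi / 2 -> t / 2 <= sin t.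
Proof.
move=> /andP[t_ge0 t_le].
have pi_gt0 := @pi_gt0 R.
pose u := t / 2.
have u_ge0 : 0 <= u by rewrite /u; lra.
have [c c_in sinu] : exists2 c, c \in `[0, u]%R & sin u - sin 0 = cos c * (u - 0).
  apply: MVT_segment => //.
  by apply: continuous_subspaceT => y; exact: continuous_sin.
move: c_in; rewrite in_itv /= => /andP[c_ge0 c_le].
have cos_u_ge0 : 0 <= cos u by apply: cos_ge0_pihalf; apply/andP; split; rewrite /u; lra.
have cos_u2 : 1 / 2 <= cos u ^+ 2.
  have : 0 <= cos t by apply: cos_ge0_pihalf; apply/andP; split; lra.
  have -> : t = u *+ 2 by rewrite /u mulr2n; lra.
  by rewrite cos_mulr2n mulr2n; lra.
have cosc : cos u <= cos c.
  rewrite leNgt (ltr_cos _ _) ?in_itv /= -?leNgt //; apply/andP; split; rewrite /u in c_le *; lra.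
rewrite sin0 !subr0 in sinu.
have sint : sin t = (cos u * (cos c * u)) *+ 2.
  by rewrite -sinu -sin_mulr2n; congr sin; rewrite /u mulr2n; lra.
rewrite sint -/u -mulr_natl.
have h : cos u * (cos u * u) <= cos u * (cos c * u).
  by apply: ler_wpM2l => //; apply: ler_wpM2r.
apply: (@le_trans _ _ (2 * (cos u * (cos u * u)))); last by rewrite ler_pM2l.
rewrite (mulrA (cos u)) -expr2 mulrA -[leLHS]mul1r; apply: ler_wpM2r => //.
by rewrite mulrC -ler_pdivrMr.
Qed.

End Expe.

(** * Distance to the nearest integer and the bound for geometric sums *)

Section DistZ.
Variable R : realType.
Implicit Types (a A : R).

Definition fracr a : R := a - (Num.floor a)%:~R.
Definition distZ a : R := Num.min (fracr a) (1 - fracr a).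
(* This is [min A (1 / distZ a)], with value [A] when [distZ a = 0]. *)
Definition capped A a : R := (Num.max A^-1 (distZ a))^-1.

Lemma fracr_ge0 a : 0 <= fracr a.
Proof. by rewrite subr_ge0 floor_le. Qed.

Lemma fracr_lt1 a : fracr a < 1.
Proof. by rewrite ltrBlDl -[1]/(1%:~R) -intrD floorD1_gt. Qed.

Lemma distZ_ge0 a : 0 <= distZ a.
Proof. by rewrite le_min fracr_ge0 subr_ge0 ltW ?fracr_lt1. Qed.

Lemma capped_ge0 A a : 0 <= capped A a.
Proof. by rewrite invr_ge0 le_max distZ_ge0 orbT. Qed.

Lemma capped_le A a : 0 < A -> capped A a <= A.
Proof.
move=> A_gt0; rewrite /capped invf_ple ?posrE //; first by rewrite le_max lexx.
by rewrite lt_max invr_gt0 A_gt0.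
Qed.

Lemma capped_le_inv A a b : 0 < A -> 0 < b -> b <= distZ a -> capped A a <= b^-1.
Proof.
move=> A_gt0 b_gt0 hb; rewrite /capped lef_pV2 ?posrE //.
  by rewrite le_max hb orbT.
by rewrite lt_max invr_gt0 A_gt0.
Qed.

Lemma le_capped A B a : 0 < A -> A <= B -> capped A a <= capped B a.
Proof.
move=> A_gt0 AB; have B_gt0 := lt_le_trans A_gt0 AB.
rewrite /capped lef_pV2 ?posrE ?lt_max ?invr_gt0 ?A_gt0 ?B_gt0 //.
by rewrite ge_max !le_max lexx orbT lef_pV2 ?posrE // AB.
Qed.

Lemma expe_fracr a : expe (fracr a) = expe a.
Proof.
by rewrite /fracr expeD -mulrNz expe_int mulr1.
Qed.

(** The right side is [2 * sin (pi * f)] for the fractional part [f]. The symmetry [f -> 1 - f]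
    reduces to an angle of at most [pi / 2], where [sin_ge_half] and [pi >= 2] suffice. *)
Lemma distZ_le_norm_expe a : ((2 * distZ a)%:C)%C <= `|1 - expe a|.
Proof.
rewrite -expe_fracr /expe normc_def lecR /=.
have f_ge0 := fracr_ge0 a; have f_lt1 := fracr_lt1 a.
rewrite /distZ; move: (fracr a) f_ge0 f_lt1 => f f_ge0 f_lt1.
have pi_ge2 := @pi_ge2 R.
have h2 : 2 * pi * f = (pi * f) *+ 2 by rewrite mulr2n; ring.
rewrite h2.
have -> : (1 - cos (pi * f *+ 2)) ^+ 2 + (0 - sin (pi * f *+ 2)) ^+ 2
    = (2 * sin (pi * f)) ^+ 2.
  rewrite cos_mulr2n sin_mulr2n !mulr2n.
  have := cos2Dsin2 (pi * f).
  move: (cos _) (sin _) => c s cs.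
  have c2 : c ^+ 2 = 1 - s ^+ 2 by rewrite -cs; ring.
  have -> : (0 - (c * s + c * s)) ^+ 2 = 4 * c ^+ 2 * s ^+ 2 by ring.
  by rewrite c2; ring.
rewrite sqrtr_sqr; apply: le_trans (ler_norm _).
rewrite ler_pM2l //.
have [f_le|f_gt] := lerP f (1 / 2).
  apply: (@le_trans _ _ f); first by rewrite ge_min lexx.
  apply: le_trans (sin_ge_half _); first by nra.
  by apply/andP; split; nra.
apply: (@le_trans _ _ (1 - f)); first by rewrite ge_min lexx orbT.
have -> : sin (pi * f) = sin (pi * (1 - f)).
  by rewrite mulrBr mulr1 sinB sinpi cospi mul0r sub0r mulN1r opprK.
apply: le_trans (sin_ge_half _); first by nra.
by apply/andP; split; nra.
Qed.

(** The sum is at most its number of terms [M], and multiplied by [1 - expe a] it telescopes to a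
    difference of two unit vectors. *)
Lemma norm_sum_expe_le a A M : 0 < A -> M%:R <= A ->
  `|\sum_(1 <= m < M.+1) expe (a * m%:R)| <= ((capped A a)%:C)%C.
Proof.
move=> A_gt0 MA.
set S := \sum_(_ <= _ < _) _.
have [s Ss] : exists s, `|S| = (s%:C)%C by rewrite normc_def; eexists.
rewrite Ss lecR.
have s_ge0 : 0 <= s by rewrite -lecR -Ss normr_ge0.
have s_le : s <= A.
  apply: le_trans MA; rewrite -lecR -Ss.
  apply: le_trans (ler_norm_sum _ _ _) _.
  under eq_bigr do rewrite norm_expe.
  by rewrite big_const_nat iter_addr addr0 subn1 /= rmorph_nat.
(* The product form also covers [distZ a = 0]. *)
have sd : s * distZ a <= 1.
  suff : s * (2 * distZ a) <= 2 by lra.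
  rewrite -lecR rmorphM /= -Ss.
  apply: (@le_trans _ _ (`|S| * `|1 - expe a|)).
    by rewrite ler_wpM2l // distZ_le_norm_expe.
  rewrite -normrM.
  have -> : S * (1 - expe a) = expe a - expe a ^+ M.+1.
    rewrite /S big_distrl /= -[RHS]opprB -[expe a in RHS]expr1.
    rewrite -(telescope_sumr (fun m => expe a ^+ m)) // -sumrN.
    apply: eq_bigr => m _.
    by rewrite expeMn mulrBr mulr1 -exprSr opprB.
  apply: le_trans (ler_normB _ _) _.
  by rewrite normrX norm_expe expr1n rmorph_nat.
rewrite /capped -[s]invrK.
have [->|s_neq0] := eqVneq s 0.
  by rewrite invr0 invr0 invr_ge0 le_max distZ_ge0 orbT.
have s_gt0 : 0 < s by rewrite lt_def s_neq0.
rewrite lef_pV2 ?posrE ?invr_gt0 ?lt_max ?invr_gt0 ?A_gt0 //.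
rewrite ge_max lef_pV2 ?posrE // s_le /=.
by rewrite -[s^-1]mul1r ler_pdivlMr // mulrC.
Qed.

End DistZ.

(** * Vaughan's lemma *)

Lemma ler_sum_uniq_sub (R : numDomainType) (T : eqType) (s1 s2 : seq T) (F : T -> R) :
  uniq s1 -> uniq s2 -> {subset s1 <= s2} -> (forall i, i \in s2 -> 0 <= F i) ->
  \sum_(i <- s1) F i <= \sum_(i <- s2) F i.
Proof.
move=> u1 u2 s12 F_ge0.
have p : perm_eq s1 [seq i <- s2 | i \in s1].
  apply: uniq_perm => //; first by rewrite filter_uniq.
  by move=> i; rewrite mem_filter; case: (boolP (i \in s1)) => //= /s12 ->.
rewrite (perm_big _ p) big_filter big_mkcond /= big_seq [leRHS]big_seq.
by apply: ler_sum => i /F_ge0; case: ifP.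
Qed.

Section Vaughan.
Variable R : realType.
Implicit Types (theta A Y : R) (a q : nat).

Definition harmsum (n : nat) : R := \sum_(1 <= t < n) t%:R^-1.

Lemma harmsum_ge0 n : 0 <= harmsum n.
Proof. by apply: sumr_ge0 => i _; rewrite invr_ge0. Qed.

Lemma le_harmsum m n : (m <= n)%N -> harmsum m <= harmsum n.
Proof.
move=> mn; apply: ler_sum_uniq_sub; rewrite ?iota_uniq //.
by move=> i; rewrite !mem_index_iota => /andP[-> /leq_trans ->].
Qed.

(** Since [0 < m < q] and [a] is coprime to [q], the integer [a * m - z * q] is nonzero, so
    [a * m / q] is at least [1 / q] from [z]. Replacing [a / q] by [theta] moves this point by at
    most [m / q ^ 2 <= 1 / (2 * q)]. *)
Lemma approx_spacing theta a q (m : nat) (z : int) :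
  (0 < q)%N -> coprime a q -> `|theta - a%:R / q%:R| <= 1 / q%:R ^+ 2 ->
  (0 < m)%N -> (2 * m <= q)%N ->
  (2 * q%:R)^-1 <= `|theta * m%:R - z%:~R|.
Proof.
move=> q_gt0 co_aq th_le m_gt0 m_le.
have q_gt0' : 0 < q%:R :> R by rewrite ltr0n.
pose w : int := (a%:Z * m%:Z - z * q%:Z)%R.
have w_neq0 : w != 0.
  apply/eqP => w0.
  have /eqP : (a%:Z * m%:Z = z * q%:Z)%R by apply/eqP; rewrite -subr_eq0 -/w w0.
  move=> /eqP h; have : (q %| a * m)%N.
    have : (q%:Z %| (a * m)%N%:Z)%Z by rewrite PoszM h dvdz_mull.
    by rewrite dvdzE.
  rewrite Gauss_dvdr 1?coprime_sym // => /(dvdn_leq m_gt0); lia.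
have w_ge1 : 1 <= `|w%:~R| :> R.
  by rewrite -intr_norm -[1]/(1%:~R) ler_int -gtz0_ge1 normr_gt0.
have e1 : theta * m%:R - z%:~R
    = w%:~R / q%:R + (theta - a%:R / q%:R) * m%:R.
  rewrite /w intrB !intrM /= -!pmulrn; field.
  by rewrite gt_eqF.
have h1 : q%:R^-1 <= `|w%:~R / q%:R : R|.
  by rewrite normrM normfV (gtr0_norm q_gt0') -[leLHS]mul1r ler_wpM2r // invr_ge0 ltW.
have h2 : `|(theta - a%:R / q%:R) * m%:R| <= (2 * q%:R)^-1.
  rewrite normrM normr_nat; apply: le_trans (ler_wpM2r _ th_le) _ => //.
  have m_le' : 2 * m%:R <= q%:R :> R by rewrite -natrM ler_nat.
  rewrite -(@ler_pM2r _ (2 * q%:R ^+ 2)) ?mulr_gt0 ?exprn_gt0 //.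
  have -> : 1 / q%:R ^+ 2 * m%:R * (2 * q%:R ^+ 2) = 2 * m%:R :> R.
    by field; rewrite gt_eqF.
  have -> : (2 * q%:R)^-1 * (2 * q%:R ^+ 2) = q%:R :> R.
    by field; rewrite gt_eqF.
  exact: m_le'.
have := lerB_normD (w%:~R / q%:R) ((theta - a%:R / q%:R) * m%:R).
rewrite -e1; apply: le_trans; apply: le_trans (lerB h1 h2).
have -> : (2 * q%:R)^-1 = q%:R^-1 / 2 :> R by field; rewrite gt_eqF.
lra.
Qed.

Section Approx.
Variables (theta : R) (a q : nat).
Hypotheses (q_gt0 : (0 < q)%N) (co_aq : coprime a q).
Hypothesis theta_le : `|theta - a%:R / q%:R| <= 1 / q%:R ^+ 2.

Local Notation Q := (2 * q%:R : R).
Let Q_gt0 : 0 < Q. Proof. by rewrite mulr_gt0 ?ltr0n. Qed.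
(* Within [q / 2] consecutive integers [l] the points [theta * l] are [1 / Q]-separated mod 1,
   so they fall into distinct buckets. *)
Let bucket (l : nat) : nat := Num.truncn (Q * fracr (theta * l%:R)).

Let bucket_itv l : (bucket l)%:R <= Q * fracr (theta * l%:R) < (bucket l)%:R + 1.
Proof. by rewrite natr1 truncn_itv // mulr_ge0 ?fracr_ge0 // ltW. Qed.

Let bucket_lt l : (bucket l < 2 * q)%N.
Proof.
rewrite -(ltr_nat R) natrM; have /andP[+ _] := bucket_itv l.
move/le_lt_trans; apply; rewrite -[ltRHS]mulr1 ltr_pM2l //; exact: fracr_lt1.
Qed.

Lemma distZ_approx_ge m : (0 < m)%N -> (2 * m <= q)%N ->
  Q^-1 <= distZ (theta * m%:R).
Proof.
move=> m_gt0 m_le; rewrite le_min; apply/andP; split.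
  have := approx_spacing (Num.floor (theta * m%:R)) q_gt0 co_aq theta_le m_gt0 m_le.
  by rewrite ger0_norm // fracr_ge0.
have := approx_spacing (Num.floor (theta * m%:R) + 1) q_gt0 co_aq theta_le m_gt0 m_le.
have -> : theta * m%:R - (Num.floor (theta * m%:R) + 1)%:~R
    = - (1 - fracr (theta * m%:R)) by rewrite intrD /fracr; ring.
by rewrite normrN ger0_norm // subr_ge0 ltW ?fracr_lt1.
Qed.

(** Sharing a bucket would put [theta * (l' - l)] within less than [1 / Q] of an integer, against
    [approx_spacing]. *)
Let bucket_inj l l' : (l < l')%N -> (2 * (l' - l) <= q)%N -> bucket l != bucket l'.
Proof.
move=> ll' hq; apply/eqP => e.
have d_gt0 : (0 < l' - l)%N by rewrite subn_gt0.
have := approx_spacing (Num.floor (theta * l'%:R) - Num.floor (theta * l%:R))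
  q_gt0 co_aq theta_le d_gt0 hq.
rewrite natrB 1?ltnW // intrB.
have -> : theta * (l'%:R - l%:R) -
    ((Num.floor (theta * l'%:R))%:~R - (Num.floor (theta * l%:R))%:~R) =
    fracr (theta * l'%:R) - fracr (theta * l%:R) by rewrite /fracr; ring.
apply/negP; rewrite -ltNge -(@ltr_pM2l _ Q) // divff ?gt_eqF //.
rewrite -[Q in ltLHS](gtr0_norm Q_gt0) -normrM mulrBr ltr_norml.
have := bucket_itv l; have := bucket_itv l'; rewrite e.
move=> /andP[? ?] /andP[? ?]; apply/andP; split; lra.
Qed.

(** Bound for a point at distance at least [t / Q] from the integers; for [t = 0] only the cap [A]
    is available. *)
Let weight A (t : nat) : R := if t == 0%N then A else Q / t%:R.

Let weight_ge0 A t : 0 < A -> 0 <= weight A t.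
Proof. by move=> A0; rewrite /weight; case: ifP => // _; rewrite ?divr_ge0 // ltW. Qed.

Let capped_weight A (l t : nat) : 0 < A -> t%:R <= Q * distZ (theta * l%:R) ->
  capped A (theta * l%:R) <= weight A t.
Proof.
move=> A_gt0 ht; rewrite /weight; case: eqP => [_|/eqP t0]; first exact: capped_le.
have t_gt0 : 0 < t%:R :> R by rewrite ltr0n lt0n.
rewrite -[Q / _]invf_div; apply: capped_le_inv; rewrite ?divr_gt0 //.
by rewrite ler_pdivrMr // mulrC.
Qed.

(** The points occupy distinct buckets among [2 * q], so the sum is at most the total weight of all
    buckets, taken once by distance from 0 and once by distance from 1. *)
Lemma sum_capped_spaced A (s : seq nat) : 0 < A -> uniq s ->
  {in s &, forall l l', (l < l')%N -> (2 * (l' - l) <= q)%N} ->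
  \sum_(l <- s) capped A (theta * l%:R) <= 2 * (A + Q * harmsum (2 * q)).
Proof.
move=> A_gt0 s_uniq s_sp.
pose G t := weight A t + weight A (2 * q - 1 - t)%N.
have G_ge0 t : 0 <= G t by rewrite addr_ge0 ?weight_ge0.
apply: (@le_trans _ _ (\sum_(l <- s) G (bucket l))).
  apply: ler_sum => l _; rewrite /G.
  have := bucket_lt l; have := bucket_itv l.
  set f := fracr _; set t := bucket l => /andP[t_le t_gt] t_lt.
  have [fl|fr] := lerP f (1 - f).
    apply: le_trans (_ : _ <= weight A t) _; last by rewrite lerDl weight_ge0.
    by apply: capped_weight => //; rewrite /distZ -/f min_l.
  (* Here the nearest integer lies above, and [Q * f < t + 1] gives [Q * (1 - f) > Q - 1 - t]. *)
  apply: le_trans (_ : _ <= weight A (2 * q - 1 - t)%N) _; last by rewrite lerDr weight_ge0.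
  apply: capped_weight => //; rewrite /distZ -/f min_r ?ltW //.
  have -> : ((2 * q - 1 - t)%N%:R : R) = Q - 1 - t%:R.
    by rewrite !natrB ?natrM //; lia.
  by rewrite mulrBr mulr1; lra.
rewrite -(big_map bucket xpredT G).
apply: (@le_trans _ _ (\sum_(0 <= t < 2 * q) G t)).
  apply: ler_sum_uniq_sub => //; rewrite ?iota_uniq //.
    rewrite map_inj_in_uniq // => l l' ls l's e.
    have [ll'|l'l|//] := ltngtP l l'.
      by have := bucket_inj ll' (s_sp _ _ ls l's ll'); rewrite e eqxx.
    by have := bucket_inj l'l (s_sp _ _ l's ls l'l); rewrite e eqxx.
  by move=> t /mapP[l _ ->]; rewrite mem_index_iota /=.
have weightE : \sum_(0 <= t < 2 * q) weight A t = A + Q * harmsum (2 * q).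
  rewrite big_ltn; last by lia.
  rewrite /harmsum big_distrr /=; congr (_ + _).
  by apply: eq_big_nat => -[|t].
rewrite big_split /= weightE.
have -> : \sum_(0 <= t < 2 * q) weight A (2 * q - 1 - t) = A + Q * harmsum (2 * q).
  rewrite -weightE [RHS]big_nat_rev /= add0n; apply: eq_big_nat => t _.
  by congr (weight _ _); lia.
lra.
Qed.

(** The range is cut into blocks of length [M]. Block [j >= 1] has cap [Y / (j * M)], and summing
    over [j] produces the second harmonic sum. The block starting at 1 gets the cap [Q] in place of
    one depending on [Y], since there [theta * l] stays [1 / Q] away from the integers. *)
Lemma sum_capped_le (L : nat) (Y : R) : 0 < Y ->
  \sum_(1 <= l < L.+1) capped (Y / l%:R) (theta * l%:R) <=
  4 * q%:R + 4 * harmsum (2 * q) * (q%:R + 2 * L%:R)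
    + 4 * (Y / q%:R) * harmsum L.+1.
Proof.
move=> Y_gt0; have q_gt0' : 0 < q%:R :> R by rewrite ltr0n.
pose F l : R := capped (Y / l%:R) (theta * l%:R).
pose M := (q %/ 2).+1; pose h := harmsum (2 * q).
have h_ge0 : 0 <= h by exact: harmsum_ge0.
(* Elements of one block differ by at most [M - 1 = q %/ 2], as the spacing requires, while
   [q <= 2 * M] keeps the number of blocks of order [L / q]. *)
have M_gt0 : 0 < M%:R :> R by rewrite ltr0n.
have qM : q%:R <= 2 * M%:R :> R by rewrite -natrM ler_nat /M; lia.
have MqN : (M <= q)%N by rewrite /M; lia.
have spaced n : {in index_iota (n * M) (n.+1 * M) &,
    forall l l', (l < l')%N -> (2 * (l' - l) <= q)%N}.
  by move=> l l'; rewrite !mem_index_iota /M; clear; lia.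
have blocks J : \sum_(1 <= l < J.+1 * M) F l <=
    2 * (Q + Q * h) + \sum_(1 <= j < J.+1) 2 * (Y / (j%:R * M%:R) + Q * h).
  elim: J => [|J IH].
    rewrite [X in _ + X]big_geq // addr0 mul1n.
    apply: le_trans (sum_capped_spaced Q_gt0 (iota_uniq 1 (M - 1)) _).
      rewrite /F -/(index_iota 1 M) big_seq [leRHS]big_seq; apply: ler_sum => l.
      rewrite mem_index_iota => /andP[l_gt0 l_lt].
      have dl : Q^-1 <= distZ (theta * l%:R).
        by apply: distZ_approx_ge => //; move: l_lt; rewrite /M; clear; lia.
      have Qi_gt0 : 0 < Q^-1 by rewrite invr_gt0.
      rewrite [X in _ <= X]/capped (max_r dl).
      apply: capped_le_inv => //; first by rewrite divr_gt0 // ltr0n.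
      exact: lt_le_trans dl.
    by move=> l l'; rewrite -/(index_iota 1 M) !mem_index_iota /M; clear; lia.
  rewrite (@big_cat_nat _ _ _ (J.+1 * M)) //=; try by rewrite /M; clear; lia.
  rewrite [X in _ <= _ + X]big_nat_recr //= addrA; apply: lerD => //.
  have A_gt0 : 0 < Y / (J.+1%:R * M%:R) by rewrite divr_gt0 // mulr_gt0 // ltr0n.
  apply: le_trans (sum_capped_spaced A_gt0 (iota_uniq _ _) (spaced J.+1)).
  rewrite big_seq [leRHS]big_seq; apply: ler_sum => l.
  rewrite mem_index_iota => /andP[l_ge _].
  have l_gt0 : 0 < l%:R :> R by rewrite ltr0n; apply: leq_trans l_ge.
  apply: le_capped; first by rewrite divr_gt0.
  apply: ler_wpM2l; first exact: ltW.
  by rewrite lef_pV2 ?posrE // ?mulr_gt0 ?ltr0n // -natrM ler_nat.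
(* Blocks [0] to [J] cover all [l <= L], and [J * M <= L] yields [q * J <= 2 * L]. *)
pose J := (L %/ M)%N.
have LJ : (L < J.+1 * M)%N by rewrite /J; apply: ltn_ceil.
have JL : (J <= L)%N by apply: leq_div.
have JM : (q * J <= 2 * L)%N.
  apply: (@leq_trans (2 * (J * M))); first by rewrite /M; clear; nia.
  by rewrite leq_mul2l /=; apply: leq_divM.
apply: (@le_trans _ _ (\sum_(1 <= l < J.+1 * M) F l)).
  apply: ler_sum_uniq_sub; rewrite ?iota_uniq //.
    by move=> l; rewrite !mem_index_iota; move: LJ; clear; lia.
  by move=> l _; apply: capped_ge0.
apply: le_trans (blocks J) _.
have -> : \sum_(1 <= j < J.+1) 2 * (Y / (j%:R * M%:R) + Q * h)
    = 2 * (Y / M%:R) * harmsum J.+1 + 2 * (Q * h) * J%:R.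
  under eq_bigr => j _ do rewrite mulrDr.
  rewrite big_split /= sumr_const_nat subn1 /= -[X in _ + X = _]mulr_natr.
  congr (_ + _); rewrite /harmsum big_distrr /=; apply: eq_bigr => j _.
  by rewrite invfM; ring.
have hJ : harmsum J.+1 <= harmsum L.+1 by apply: le_harmsum.
have YM : 2 * (Y / M%:R) <= 4 * (Y / q%:R).
  have -> : 2 * (Y / M%:R) = 4 * (Y / (2 * M%:R)) by field; rewrite gt_eqF.
  rewrite ler_pM2l //; apply: ler_wpM2l; first exact: ltW.
  by rewrite lef_pV2 ?posrE // mulr_gt0.
have h1 : 2 * (Y / M%:R) * harmsum J.+1 <= 4 * (Y / q%:R) * harmsum L.+1.
  apply: ler_pM => //; last exact: harmsum_ge0.
  by rewrite mulr_ge0 // divr_ge0 // ltW.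
have h2 : q%:R * J%:R <= 2 * L%:R :> R by rewrite -!natrM ler_nat.
have h3 : h * (q%:R * J%:R) <= h * (2 * L%:R) by apply: ler_wpM2l.
rewrite -/h; lra.
Qed.

End Approx.
End Vaughan.

(** * Sums over k-free integers *)

Lemma big_nat_dvdn (R : nmodType) (N D : nat) (f : nat -> R) : (0 < D)%N ->
  \sum_(1 <= n < N.+1 | (D %| n)%N) f n = \sum_(1 <= m < (N %/ D).+1) f (D * m)%N.
Proof.
move=> D_gt0; rewrite -big_filter -(big_map (muln D) xpredT f).
apply: perm_big; apply: uniq_perm.
- by rewrite filter_uniq // iota_uniq.
- by rewrite map_inj_uniq ?iota_uniq // => m n /eqP; rewrite eqn_pmul2l // => /eqP.
move=> n; rewrite mem_filter mem_index_iota ltnS; apply/andP/mapP.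
  case=> /dvdnP[m ->] /andP[m_gt0 m_le]; exists m; last by rewrite mulnC.
  by rewrite mem_index_iota ltnS leq_divRL // m_le andbT; case: (m) m_gt0.
case=> m; rewrite mem_index_iota ltnS leq_divRL // => /andP[m_gt0 m_le] ->.
by rewrite dvdn_mulr // muln_gt0 D_gt0 m_gt0 mulnC.
Qed.

Section Bounds.
Variable R : realType.
Implicit Types (x y H theta : R).

(** The Moebius identity is inserted, the sums over [n] and [d] are exchanged, and [n = d ^ k * m].
    Those [d] with [d ^ k > x] carry an empty inner sum. *)
Lemma kfree_expsumE k H x theta : (0 < k)%N ->
  kfree_expsum k H x theta =
  \sum_(1 <= h < (Num.truncn H).+1) \sum_(1 <= d < (Num.truncn x).+1)
    moebius R[i] d * \sum_(1 <= m < (Num.truncn x %/ d ^ k).+1)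
      expe (theta * (h * d ^ k)%N%:R * m%:R).
Proof.
move=> k_gt0; apply: eq_bigr => h _.
set N := Num.truncn x.
rewrite big_mkcond /=.
transitivity (\sum_(1 <= n < N.+1) \sum_(1 <= d < N.+1)
    if (d ^ k %| n)%N then moebius R[i] d * expe (theta * h%:R * n%:R) else 0).
  apply: eq_big_nat => n; rewrite ltnS => n_in; rewrite -big_mkcond /=.
  rewrite -big_distrl /= sum_moebius_kpower //.
  by case: ifP => _; rewrite ?mul1r ?mul0r.
rewrite exchange_big /=; apply: eq_big_nat => d /andP[d_gt0 _].
rewrite -big_mkcond /= -big_distrr /= big_nat_dvdn ?expn_gt0 ?d_gt0 //.
congr (_ * _); apply: eq_bigr => m _.
by congr expe; rewrite !natrM !mulrA.
Qed.

Lemma norm_kfree_expsum_le k H x theta : (0 < k)%N -> 0 < x ->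
  `|kfree_expsum k H x theta| <=
  ((\sum_(1 <= h < (Num.truncn H).+1) \sum_(1 <= d < (Num.truncn x).+1)
     capped (x / (d ^ k)%N%:R) (theta * (h * d ^ k)%N%:R))%:C)%C.
Proof.
move=> k_gt0 x_gt0; rewrite kfree_expsumE // rmorph_sum.
apply: le_trans (ler_norm_sum _ _ _) _; apply: ler_sum => h _.
rewrite rmorph_sum; apply: le_trans (ler_norm_sum _ _ _) _.
rewrite big_seq [leRHS]big_seq; apply: ler_sum => d.
rewrite mem_index_iota => /andP[d_gt0 _].
have dk_gt0 : 0 < (d ^ k)%N%:R :> R by rewrite ltr0n expn_gt0 d_gt0.
rewrite normrM; apply: le_trans (ler_wpM2r (normr_ge0 _) (norm_moebius_le1 _ _)) _.
rewrite mul1r; apply: norm_sum_expe_le; first exact: divr_gt0.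
rewrite ler_pdivlMr // -natrM; apply: le_trans (_ : (Num.truncn x)%:R <= x).
  by rewrite ler_nat leq_divM.
by rewrite truncn_le ltW.
Qed.

(** Telescoping of [1 / (u + 1) ^ 2 <= 1 / u - 1 / (u + 1)]. *)
Lemma sum_invr_sqr_le (D N : nat) : (0 < D)%N ->
  \sum_(D.+1 <= d < N) d%:R^-2 <= D%:R^-1 :> R.
Proof.
move=> D_gt0; have [ND|DN] := leqP N D.+1.
  by rewrite big_geq // invr_ge0.
suff h n : \sum_(D.+1 <= d < D.+1 + n) d%:R^-2 <= D%:R^-1 - (D + n)%N%:R^-1 :> R.
  rewrite -(subnKC (ltnW DN)); apply: le_trans (h _) _.
  by rewrite gerBl invr_ge0.
elim: n => [|n IH]; first by rewrite addn0 big_geq // addn0 subrr.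
rewrite addnS big_nat_recr /=; last by rewrite leq_addr.
apply: le_trans (lerD IH (lexx _)) _.
rewrite addSn addnS -natr1.
have : 0 < (D + n)%N%:R :> R by rewrite ltr0n addn_gt0 D_gt0.
move: (_%:R) => u u_gt0.
have u1_gt0 : 0 < u + 1 by lra.
rewrite -subr_ge0.
have -> : D%:R^-1 - (u + 1)^-1 - (D%:R^-1 - u^-1 + (u + 1)^-2) = (u * (u + 1) ^+ 2)^-1.
  have D0 : D%:R != 0 :> R by rewrite pnatr_eq0 -lt0n.
  by field; rewrite D0 !gt_eqF.
by rewrite invr_ge0 mulr_ge0 ?exprn_ge0 // ltW.
Qed.

(** For [d > y] write [x = y ^ (k + 1) * y ^ (k - 2)] to get [x / d ^ k <= y ^ (k + 1) / d ^ 2]. The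
    sum of [1 / d ^ 2] is at most [1 / D], and [y < D + 1 <= 2 * D]. *)
Lemma sum_kpower_tail_le k x y (N : nat) : (2 <= k)%N -> 1 <= y -> x = y ^+ (2 * k - 1) ->
  \sum_((Num.truncn y).+1 <= d < N) x / (d ^ k)%N%:R <= 2 * y ^+ k.
Proof.
move=> k_ge2 y_ge1 xy; set D := Num.truncn y.
have y_gt0 : 0 < y by lra.
have D_gt0 : (0 < D)%N by rewrite truncn_gt0.
have yD : y < D%:R + 1 by rewrite natr1 truncnS_gt.
have D_ge1 : 1 <= D%:R :> R by rewrite ler1n.
apply: (@le_trans _ _ (y ^+ k.+1 * \sum_(D.+1 <= d < N) d%:R^-2)).
  rewrite big_distrr /= big_seq [leRHS]big_seq; apply: ler_sum => d.
  rewrite mem_index_iota => /andP[Dd _].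
  have yd : y <= d%:R by apply: le_trans (ltW yD) _; rewrite natr1 ler_nat.
  have d_gt0 : 0 < d%:R :> R by lra.
  rewrite natrX ler_pdivrMr ?exprn_gt0 // xy.
  have -> : (2 * k - 1 = k.+1 + (k - 2))%N by lia.
  rewrite exprD -mulrA ler_pM2l ?exprn_gt0 //.
  have -> : d%:R ^- 2 * d%:R ^+ k = d%:R ^+ (k - 2) :> R.
    by rewrite -{1}(subnKC k_ge2) exprD mulrA mulVf ?mul1r // expf_neq0 // gt_eqF.
  by rewrite lerXn2r ?nnegrE // ltW.
apply: (@le_trans _ _ (y ^+ k.+1 * D%:R^-1)).
  by rewrite ler_pM2l ?exprn_gt0 // sum_invr_sqr_le.
rewrite exprSr -mulrA [2 * _]mulrC ler_pM2l ?exprn_gt0 //.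
by rewrite ler_pdivrMr; lra.
Qed.

(** For fixed [d] the map from [h] to [l = h * d ^ k] is injective with values among the multiples
    of [d]; so each [l] is hit at most once per divisor. *)
Lemma sum_kpower_head_le k (M D : nat) (F : nat -> R) W : (0 < k)%N ->
  (forall l, 0 <= F l) ->
  (forall l, (0 < l <= M * D ^ k)%N -> (size (divisors l))%:R <= W) ->
  \sum_(1 <= h < M.+1) \sum_(1 <= d < D.+1) F (h * d ^ k)%N <=
  W * \sum_(1 <= l < (M * D ^ k).+1) F l.
Proof.
move=> k_gt0 F_ge0 hW; rewrite exchange_big /=; set L := (M * D ^ k)%N.
apply: (@le_trans _ _ (\sum_(1 <= d < D.+1) \sum_(1 <= l < L.+1 | (d %| l)%N) F l)).
  rewrite big_seq [leRHS]big_seq; apply: ler_sum => d.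
  rewrite mem_index_iota => /andP[d_gt0 dD].
  have dk_gt0 : (0 < d ^ k)%N by rewrite expn_gt0 d_gt0.
  rewrite -(big_map (fun h => h * d ^ k)%N xpredT F) -[leRHS]big_filter.
  apply: ler_sum_uniq_sub => //.
  - by rewrite map_inj_uniq ?iota_uniq // => m n /eqP; rewrite eqn_pmul2r // => /eqP.
  - by rewrite filter_uniq // iota_uniq.
  move=> l /mapP[h]; rewrite mem_index_iota ltnS => /andP[h_gt0 hM] ->.
  rewrite mem_filter mem_index_iota ltnS muln_gt0 h_gt0 dk_gt0 /=.
  rewrite dvdn_mull ?dvdn_exp //= leq_mul //.
  by case: (k) k_gt0 => // k' _; rewrite leq_exp2r.
rewrite (exchange_big_dep xpredT) //= big_distrr /= big_seq [leRHS]big_seq.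
apply: ler_sum => l; rewrite mem_index_iota => l_in.
apply: le_trans (ler_wpM2r (F_ge0 l) (hW l _)) => //.
rewrite mulr_natl -big_filter.
have -> : F l *+ size (divisors l) = \sum_(d <- divisors l) F l.
  by rewrite big_const_seq count_predT iter_addr addr0.
apply: ler_sum_uniq_sub; rewrite ?divisors_uniq ?filter_uniq ?iota_uniq //.
move=> d; rewrite mem_filter -dvdn_divisors; first by case/andP.
by case/andP: l_in.
Qed.

(** Induction with [1 / (n + 2) <= ln (n + 2) - ln (n + 1)], an instance of [ln (1 + t) <= t]. *)
Lemma harmsum_le_ln n : harmsum R n.+2 <= 1 + ln n.+1%:R.
Proof.
elim: n => [|n IH]; first by rewrite /harmsum big_nat1 ln1 invr1 addr0.
rewrite /harmsum big_nat_recr //= -/(harmsum R n.+2).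
have n1 : 0 < n.+1%:R :> R by [].
have n2 : 0 < n.+2%:R :> R by [].
have : ln (1 + (- n.+2%:R^-1)) <= - n.+2%:R^-1 :> R.
  apply: le_ln1Dx; rewrite ltrN2 invf_lt1 // ltr1n //.
have -> : 1 + (- n.+2%:R^-1) = n.+1%:R / n.+2%:R :> R.
  have n21 : n.+2%:R = n.+1%:R + 1 :> R by rewrite natr1.
  by rewrite n21 in n2 *; move: n1 n2; move: (n.+1%:R) => u *; field; rewrite gt_eqF.
rewrite ln_div ?posrE // lerBlDr => h.
apply: (@le_trans _ _ (1 + ln n.+1%:R + n.+2%:R^-1)); first by rewrite lerD2r.
by rewrite -addrA lerD2l -lerBrDr addrC.
Qed.

(** Uses [delta * ln B = ln (B]^ delta) < B [^ delta]. *)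
Lemma harmsum_le_powR n B delta : 1 <= B -> 0 < delta -> n%:R <= B ->
  harmsum R n.+1 <= (1 + delta^-1) * B `^ delta.
Proof.
move=> B_ge1 d_gt0 nB; have B_gt0 : 0 < B by lra.
have Bd_ge1 : 1 <= B `^ delta by rewrite -[leLHS](powRr0 B) ler_powR // ltW.
have lnB : ln B <= delta^-1 * B `^ delta.
  rewrite mulrC ler_pdivlMr // mulrC -ln_powR.
  by apply: ltW; apply: ln_sublinear; rewrite powR_gt0.
have lnB_ge0 : 0 <= ln B by apply: ln_ge0.
apply: (@le_trans _ _ (1 + ln B)); last by rewrite mulrDl mul1r lerD.
case: n nB => [|n] nB; first by rewrite /harmsum big_geq // addr_ge0.
by apply: le_trans (harmsum_le_ln n) _; rewrite lerD2l ler_ln ?posrE.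
Qed.

(** Take [j] with [1 / j <= delta] and extract the [j]-th root in [size_divisors_le]. *)
Lemma size_divisors_le_powR delta : 0 < delta ->
  exists2 K : R, 0 < K &
    forall n, (0 < n)%N -> (size (divisors n))%:R <= K * n%:R `^ delta.
Proof.
move=> d_gt0; pose j := (Num.truncn delta^-1).+1.
have j_gt0 : 0 < j%:R :> R by rewrite ltr0n.
have jd : j%:R^-1 <= delta.
  by rewrite invf_ple ?posrE //; apply/ltW/truncnS_gt.
have [K K_gt0 hK] := @size_divisors_le j isT.
exists (K%:R `^ delta) => [|n n_gt0]; first by rewrite powR_gt0 // ltr0n.
rewrite -powRM // -natrM; set s := size _.
have Kn_ge1 : 1 <= (K * n)%N%:R :> R by rewrite ler1n muln_gt0 K_gt0.
apply: le_trans (ler_powR Kn_ge1 jd).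
have -> : s%:R = ((s ^ j)%N%:R) `^ j%:R^-1 :> R.
  rewrite natrX -powR_mulrn // -powRrM divff ?gt_eqF // powRr1 //.
apply: ge0_ler_powR; rewrite ?nnegrE ?invr_ge0 //.
by rewrite ler_nat; apply: hK.
Qed.

End Bounds.

(** * Combination of the head and tail estimates *)

Theorem theorem1p3 (R : realType) (k : nat) (eps C : R) :
  (2 <= k)%N -> 0 < eps -> 0 < C ->
  exists2 K : R, 0 < K &
    \forall x \near +oo,
      forall (H theta : R) (a q : nat),
        1 <= H -> H <= C * x ->
        (0 < a)%N -> (0 < q)%N -> q%:R <= x -> coprime a q ->
        `|theta - a%:R / q%:R| <= 1 / q%:R ^+ 2 ->
        `|kfree_expsum k H x theta| <=
          (K * ((H * x `^ (k%:R / (2 * k%:R - 1)) + q%:R + H * x / q%:R)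
                * x `^ eps))%:C%C.
Proof.
move=> k_ge2 eps_gt0 C_gt0; have k_gt0 := ltnW k_ge2.
have k_le : (k <= 2 * k - 1)%N by lia.
have k2_gt0 := leq_trans k_gt0 k_le.
(* All relevant arguments will be at most [(C + 2) * x ^ 2], whose [delta]-th power is [E] times [x]
   to the [eps / 2]. The divisor bound and the harmonic sums each cost one such factor. *)
pose delta := eps / 4.
have d_gt0 : 0 < delta by rewrite divr_gt0.
have [Kd Kd_gt0 hKd] := size_divisors_le_powR d_gt0.
pose E := (C + 2) `^ delta.
have E_gt0 : 0 < E by rewrite powR_gt0 // addr_gt0.
pose c1 := Kd * E; pose c2 := (1 + delta^-1) * E.
have c1_gt0 : 0 < c1 by rewrite mulr_gt0.
have c2_gt0 : 0 < c2 by rewrite mulr_gt0 // addr_gt0 // invr_gt0.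
(* The 2 comes from the tail, [4 * c1] from the harmonic-free term [4 * q], and [8 * (c1 * c2)] from
   the term with [2 * (H * y ^+ k)]. *)
exists (2 + 4 * c1 + 8 * (c1 * c2)).
  by have := mulr_gt0 c1_gt0 c2_gt0; lra.
apply: filterS (nbhs_pinfty_ge (num_real 1)) => x x_ge1 H theta a q.
move=> H_ge1 H_le a_gt0 q_gt0 q_le co_aq th_le.
have x_gt0 : 0 < x by lra.
have H_gt0 : 0 < H by lra.
have q_gt0' : 0 < q%:R :> R by rewrite ltr0n.
apply: le_trans (norm_kfree_expsum_le _ _ k_gt0 x_gt0) _; rewrite lecR.
have natr_2k1 : (2 * k - 1)%N%:R = 2 * k%:R - 1 :> R.
  by rewrite natrB ?natrM // muln_gt0 k_gt0.
have k2_neq0 : (2 * k - 1)%N%:R != 0 :> R by rewrite pnatr_eq0 -lt0n.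
pose y := x `^ ((2 * k - 1)%N%:R)^-1.
have y_ge1 : 1 <= y.
  by rewrite -[leLHS](powRr0 x) ler_powR // invr_ge0.
have xy : x = y ^+ (2 * k - 1).
  by rewrite -powR_mulrn ?powR_ge0 // -powRrM mulVf // powRr1 // ltW.
have yk : x `^ (k%:R / (2 * k%:R - 1)) = y ^+ k.
  by rewrite -powR_mulrn ?powR_ge0 // -powRrM -natr_2k1 mulrC.
have yk_le : y ^+ k <= x.
  by rewrite xy; apply: ler_weXn2l.
have yk_gt0 : 0 < y ^+ k by rewrite exprn_gt0 //; lra.
pose G := x `^ (eps / 2).
have G_ge1 : 1 <= G by rewrite -[leLHS](powRr0 x) ler_powR // divr_ge0 // ltW.
have GG : x `^ eps = G * G.
  rewrite /G -powRD; first by congr powR; lra.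
  by rewrite (gt_eqF x_gt0) implybT.
(* A common bound for [L <= H * y ^ k <= C * x * x] and for [2 * q <= 2 * x]. *)
pose B := (C + 2) * x ^+ 2.
have B_ge1 : 1 <= B.
  apply: le_trans (_ : x ^+ 2 <= _); first exact: exprn_ege1.
  by rewrite ler_peMl ?sqr_ge0 //; lra.
have BG : B `^ delta = E * G.
  rewrite /B powRM ?sqr_ge0 ?addr_ge0 ?ltW // -/E -powR_mulrn ?ltW // -powRrM.
  by congr (_ * powR _ _); rewrite /delta; lra.
pose D := Num.truncn y; pose M := Num.truncn H; pose L := (M * D ^ k)%N.
have M_le : M%:R <= H by rewrite truncn_le ltW.
have D_le : D%:R <= y by rewrite truncn_le; lra.
have L_le : L%:R <= H * y ^+ k.
  rewrite natrM natrX; apply: ler_pM => //.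
  by apply: lerXn2r; rewrite ?nnegrE //; lra.
have L_leB : L%:R <= B.
  apply: le_trans L_le _; apply: le_trans (_ : (C * x) * x <= _).
    by apply: ler_pM => //; apply: ltW.
  by rewrite /B -mulrA -expr2 ler_pM2r ?exprn_gt0 // lerDl.
have q_leB : (2 * q)%N%:R <= B.
  rewrite natrM; apply: ler_pM => //; first by lra.
  by apply: le_trans q_le _; rewrite expr2 ler_peMl // ltW.
have tau_le l : (0 < l <= L)%N -> (size (divisors l))%:R <= c1 * G.
  move=> /andP[l_gt0 l_le]; apply: le_trans (hKd l l_gt0) _.
  rewrite /c1 -mulrA -BG ler_pM2l //; apply: ge0_ler_powR; rewrite ?nnegrE ?(ltW d_gt0) //.
    exact: le_trans B_ge1.
  by apply: le_trans L_leB; rewrite ler_nat.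
have h1 : harmsum R L.+1 <= c2 * G.
  by rewrite /c2 -mulrA -BG; apply: harmsum_le_powR.
have h2 : harmsum R (2 * q) <= c2 * G.
  apply: le_trans (le_harmsum R (leqnSn _)) _.
  by rewrite /c2 -mulrA -BG; apply: harmsum_le_powR.
pose Y := H * x.
have Y_gt0 : 0 < Y by rewrite mulr_gt0.
pose F l := capped (Y / l%:R) (theta * l%:R).
have F_ge0 l : 0 <= F l by apply: capped_ge0.
have sumF : \sum_(1 <= l < L.+1) F l <=
    4 * q%:R + 4 * (c2 * G) * (q%:R + 2 * (H * y ^+ k)) + 4 * (Y / q%:R) * (c2 * G).
  apply: le_trans (sum_capped_le q_gt0 co_aq th_le L Y_gt0) _.
  apply: lerD; [apply: lerD => //|].
    apply: ler_pM; rewrite ?mulr_ge0 ?harmsum_ge0 ?addr_ge0 ?mulr_ge0 //.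
      by rewrite ler_pM2l.
    by rewrite lerD2l ler_pM2l.
  by rewrite ler_pM2l // mulr_gt0 // divr_gt0.
have head : \sum_(1 <= h < M.+1) \sum_(1 <= d < D.+1)
    capped (x / (d ^ k)%N%:R) (theta * (h * d ^ k)%N%:R) <=
    c1 * G * \sum_(1 <= l < L.+1) F l.
  apply: le_trans (sum_kpower_head_le k_gt0 F_ge0 tau_le).
  rewrite big_seq [leRHS]big_seq; apply: ler_sum => h.
  rewrite mem_index_iota ltnS => /andP[h_gt0 h_le].
  rewrite big_seq [leRHS]big_seq; apply: ler_sum => d.
  rewrite mem_index_iota => /andP[d_ge1 _].
  have dk_gt0 : 0 < (d ^ k)%N%:R :> R by rewrite ltr0n expn_gt0 d_ge1.
  have h_gt0' : 0 < h%:R :> R by rewrite ltr0n.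
  (* Since [h <= H], the cap [x / d ^ k = h * x / (h * d ^ k)] is at most [Y / l] with
     [l = h * d ^ k], so it depends on [l] alone. *)
  apply: le_capped; first exact: divr_gt0.
  rewrite natrM /Y.
  have -> : x / (d ^ k)%N%:R = (h%:R * x) / (h%:R * (d ^ k)%N%:R).
    by field; rewrite !gt_eqF.
  rewrite ler_pM2r ?invr_gt0 ?mulr_gt0 // ler_pM2r //.
  by apply: le_trans M_le; rewrite ler_nat.
have tail : \sum_(1 <= h < M.+1) \sum_(D.+1 <= d < (Num.truncn x).+1)
    capped (x / (d ^ k)%N%:R) (theta * (h * d ^ k)%N%:R) <= H * (2 * y ^+ k).
  apply: (@le_trans _ _ (\sum_(1 <= h < M.+1) 2 * y ^+ k)).
    apply: ler_sum => h _.
    apply: le_trans (sum_kpower_tail_le (Num.truncn x).+1 k_ge2 y_ge1 xy).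
    rewrite big_seq [leRHS]big_seq; apply: ler_sum => d.
    rewrite mem_index_iota => /andP[d_gt _]; apply: capped_le.
    by rewrite divr_gt0 // ltr0n expn_gt0 (leq_trans _ d_gt).
  rewrite sumr_const_nat subn1 /= -[leLHS]mulr_natl ler_pM2r //.
  by rewrite mulr_gt0.
have DN : (D <= Num.truncn x)%N.
  by apply: le_truncn; rewrite xy ler_eXnr.
have -> : \sum_(1 <= h < M.+1) \sum_(1 <= d < (Num.truncn x).+1)
    capped (x / (d ^ k)%N%:R) (theta * (h * d ^ k)%N%:R) =
  \sum_(1 <= h < M.+1) \sum_(1 <= d < D.+1)
    capped (x / (d ^ k)%N%:R) (theta * (h * d ^ k)%N%:R) +
  \sum_(1 <= h < M.+1) \sum_(D.+1 <= d < (Num.truncn x).+1)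
    capped (x / (d ^ k)%N%:R) (theta * (h * d ^ k)%N%:R).
  by rewrite -big_split; apply: eq_bigr => h _; rewrite (big_cat_nat (n := D.+1)).
apply: le_trans (lerD head tail) _.
rewrite yk GG -/Y.
have c1G_gt0 : 0 < c1 * G by rewrite mulr_gt0 //; lra.
apply: le_trans (lerD (ler_wpM2l (ltW c1G_gt0) sumF) (lexx _)) _.
have Yq_gt0 : 0 < Y / q%:R by rewrite divr_gt0.
have Hy_gt0 : 0 < H * y ^+ k by rewrite mulr_gt0.
rewrite [H * (2 * _)]mulrCA.
(* What remains is a polynomial inequality in [w = q], [v = H * y ^ k], [u = Y / q]. By
   [1 <= G <= G * G] every term is raised to the factor [G * G], which then cancels. *)
move: c1_gt0 c2_gt0 G_ge1 Yq_gt0 Hy_gt0 q_gt0'; clear.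
move: c1 c2 G (q%:R) (H * y ^+ k) (Y / q%:R) => {}c1 {}c2 {}G w v u.
move=> c1_gt0 c2_gt0 G_ge1 u_gt0 v_gt0 w_gt0.
have GG1 : G <= G * G by rewrite ler_peMl //; lra.
have c12 : 0 < c1 * c2 by rewrite mulr_gt0.
have GG_gt0 : 0 < G * G by rewrite mulr_gt0 //; lra.
set r := (X in X <= _).
have -> : r = 4 * (c1 * w) * G + (c1 * c2 * 4 * (w + 2 * v) + 4 * (c1 * c2) * u) * (G * G)
   + 2 * v by rewrite /r; ring.
apply: (@le_trans _ _ ((4 * (c1 * w) + (c1 * c2 * 4 * (w + 2 * v)
    + 4 * (c1 * c2) * u) + 2 * v) * (G * G))).
  rewrite !(mulrDl _ _ (G * G)); apply: lerD; [apply: lerD => //|].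
    by rewrite ler_pM2l // !mulr_gt0.
  apply: ler_peMr; first by rewrite mulr_ge0 // ltW.
  exact: le_trans GG1.
rewrite [leRHS]mulrA ler_pM2r //.
rewrite -subr_ge0.
set t := (X in 0 <= X).
have -> : t = 2 * w + 2 * u + 4 * c1 * (v + u) + 4 * (c1 * c2) * w + 4 * (c1 * c2) * u.
  by rewrite /t; ring.
by rewrite !addr_ge0 ?mulr_ge0 ?addr_ge0 ?ltW.
Qed.
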